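(* Let $W$ be an irreducible and ergodic transition matrix on a finite set $\mathcal X$, let $g:\mathcal X\times\mathcal X\to\mathbb R$ be an arbitrary function, and let $X_1,X_2,\dots$ be a Markov process with transition matrix $W$ (with arbitrary initial distribution). Let $S_n:=\frac1n\sum_{i=1}^n g(X_{i+1},X_i)$, and for $\theta\in\mathbb R$ let $\phi(\theta)$ be the logarithm of the Perron–Frobenius eigenvalue of the matrix $W(x|x')e^{\theta g(x,x')}$. Then $$\lim_{n\to\infty} n\,\mathsf V[S_n]=\frac{d^2\phi}{d\theta^2}(0),$$ where $\mathsf V[S_n]$ is the variance of $S_n$.
   Context: A transition matrix on a finite set $\mathcal X$ is a nonnegative matrix $W(x|x')$ with $\sum_x W(x|x')=1$ for every $x'$; here $W(x|x')$ is the probability that $X_{i+1}=x$ given $X_i=x'$. $W$ is irreducible if for all $x,x'$ there is $n$ with $W^n(x|x')>0$, and ergodic if it is irreducible and aperiodic. *)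

(* Defs.v *)
From HB Require Import structures.
From mathcomp Require Import all_boot all_order all_algebra.
From mathcomp Require Import complex.
From mathcomp Require Import all_classical all_reals all_analysis.

Set Implicit Arguments.
Unset Strict Implicit.
Unset Printing Implicit Defensive.

Import Order.TTheory GRing.Theory Num.Theory.
Import numFieldNormedType.Exports.

Local Open Scope classical_set_scope.
Local Open Scope ring_scope.
Local Open Scope complex_scope.

Section TransitionMatrices.
Context {R : realType} {S : finType}.
Implicit Types (A W g : S -> S -> R).

(* A square matrix indexed by [S] is given by its entries [A x x'], read
   A(x|x'): the row is the arrival state [x], the column the departure
   state [x']. *)
Definition mx_of A : 'M[R]_#|S| :=
  \matrix_(i, j) A (enum_val i) (enum_val j).

Definition mxpow A (n : nat) (x x' : S) : R :=
  (mx_of A ^+ n) (enum_rank x) (enum_rank x').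

Definition transition_matrix W : Prop :=
  (forall x x', 0 <= W x x') /\ (forall x', \sum_x W x x' = 1).

Definition irreducible W : Prop :=
  forall x x', exists n, 0 < mxpow W n x x'.

(* For every state x, the gcd of the n such that W^n(x|x) > 0 is 1;
   n = 0 does not affect the gcd. *)
Definition aperiodic W : Prop :=
  forall (x : S) (d : nat),
    (forall n, 0 < mxpow W n x x -> (d %| n)%N) -> d = 1%N.

Definition ergodic W : Prop := irreducible W /\ aperiodic W.

(* [r] is an eigenvalue that dominates the modulus of every complex
   eigenvalue. *)
Definition is_pf_eigenvalue A (r : R) : Prop :=
  eigenvalue (mx_of A) r /\
  forall z : R[i],
    eigenvalue (map_mx (real_complex R) (mx_of A)) z -> `|z| <= r%:C.

Lemma is_pf_eigenvalue_unique A (r s : R) :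
  is_pf_eigenvalue A r -> is_pf_eigenvalue A s -> r = s.
Proof.
have le r1 r2 : is_pf_eigenvalue A r1 -> is_pf_eigenvalue A r2 -> r1 <= r2.
  move=> [e1 _] [_ /(_ r1%:C)].
  rewrite eigenvalue_map => /(_ e1).
  by rewrite normc_def /= expr0n /= addr0 sqrtr_sqr lecR; exact: le_trans (ler_norm _).
by move=> hr hs; apply/eqP; rewrite eq_le !le.
Qed.

(* The value 0 is taken only if there is no such [r], which the
   Perron-Frobenius theorem excludes for irreducible nonnegative [A]. *)
Definition pf_eigenvalue A : R := xget 0 [set r | is_pf_eigenvalue A r].

Definition tilted W g (theta : R) : S -> S -> R :=
  fun x x' => W x x' * expR (theta * g x x').

Definition log_pf W g (theta : R) : R := ln (pf_eigenvalue (tilted W g theta)).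

End TransitionMatrices.

Section MarkovProcesses.
Context {d : measure_display} {T : measurableType d} {R : realType}.
Context (P : probability T R).

Definition cond_prob (A B : set T) : R := fine (P (A `&` B)) / fine (P B).

Context {S : finType}.

(* Time is counted from 0, so that [X i] is X_{i+1}. The first clause is
   measurability for the discrete sigma-algebra on [S]. *)
Definition markov_process (W : S -> S -> R) (X : nat -> T -> S) : Prop :=
  (forall i (B : set S), measurable (X i @^-1` B)) /\
  forall (n : nat) (x : nat -> S),
    let past := [set w | forall i, (i <= n)%N -> X i w = x i] in
    P past != 0%E ->
    cond_prob [set w | X n.+1 w = x n.+1] past = W (x n.+1) (x n).

Definition sample_mean (g : S -> S -> R) (X : nat -> T -> S) (n : nat) :
    T -> R :=
  fun w => n%:R^-1 * \sum_(i < n) g (X i.+1 w) (X i w).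

End MarkovProcesses.

(* Main.v *)
Require Import Defs.
From HB Require Import structures.
From mathcomp Require Import all_boot all_order all_algebra.
From mathcomp Require Import complex ring lra.
From mathcomp Require Import all_classical all_reals all_analysis.
Import Order.TTheory GRing.Theory Num.Theory.
Import numFieldNormedType.Exports.
Local Open Scope ring_scope.
Local Open Scope classical_set_scope.

Set Implicit Arguments.
Unset Strict Implicit.
Unset Printing Implicit Defensive.

(* The tilted matrix at 0 is W, whose eigenvalue 1 has the all-ones left
   eigenvector. By irreducibility 1 is a simple root of the characteristic
   polynomial, so for theta near 0 there is a root near 1, and the column sums
   of the adjugate of (lambda - tilted W g theta) give a left eigenvector close
   to a constant vector. A positive left eigenvector forces its eigenvalue to
   dominate the spectrum, so this root is the Perron-Frobenius eigenvalue.
   Differentiating the eigenvalue equation twice at 0 yields m = phi'(0), h and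
   f such that D(x,x') = g(x,x') - m + h(x) - h(x') has conditional mean 0 and
   conditional variance phi''(0) + f(x') - E[f(X_{i+1}) | X_i = x'].
   Hence sum (g - m) is a martingale M_n plus the bounded boundary term
   h(X_0) - h(X_n), and E[M_n^2] telescopes to n phi''(0) + O(1). *)

(** * Spectral bound from a positive test vector *)

Section DominatedSpectrum.
Context {R : realType} {n : nat}.
Implicit Types (A : 'M[R]_n) (v : 'rV[R]_n).

(** Collatz-Wielandt argument: at an index [j] maximising |w_j|/v_j for the left eigenvector [w],
    the triangle inequality in w A = z w gives |z| |w_j| <= (|w_j|/v_j) (v A)_j <= c |w_j|. *)
Lemma norm_eigenvalue_le A v (c : R) (z : R[i]) :
  (forall i j, 0 <= A i j) -> (forall j, 0 < v 0 j) ->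
  (forall j, (v *m A) 0 j <= c * v 0 j) ->
  eigenvalue (map_mx (real_complex R) A) z -> `|z| <= (c%:C)%C.
Proof.
move=> A0 v0 vA /eigenvalueP[w wA w0].
have [j0 wj0] : exists j, w 0 j != 0.
  by move/rV0Pn: w0.
pose f j := Normc.normc (w 0 j) / v 0 j.
pose j := [arg max_(j > j0) f j]%O.
have fj i : f i <= f j.
  by rewrite /j; case: arg_maxP => // k _; exact.
have normcE (x : R[i]) : `|x| = ((Normc.normc x)%:C)%C.
  by rewrite normc_def; case: x.
have wle i : Normc.normc (w 0 i) <= f j * v 0 i by rewrite -ler_pdivrMr//; exact: fj.
have fj0 : 0 < f j.
  rewrite (lt_le_trans _ (fj j0))// divr_gt0//.
  by rewrite -ltcR -normcE normr_gt0.
have h : `|z| * `|w 0 j| <= ((f j * (c * v 0 j))%:C)%C.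
  rewrite -normrM; have -> : z * w 0 j = (z *: w) 0 j by rewrite mxE.
  rewrite -wA mxE (le_trans (ler_norm_sum _ _ _))//.
  rewrite (@le_trans _ _ (\sum_i ((f j * v 0 i * A i j)%:C)%C))//.
    apply: ler_sum => i _; rewrite mxE normrM rmorphM ler_pM//.
      by rewrite normcE lecR.
    by rewrite normc_def /= expr0n addr0 sqrtr_sqr ger0_norm.
  rewrite -rmorph_sum lecR; under eq_bigr do rewrite -mulrA.
  by rewrite -mulr_sumr ler_wpM2l ?(ltW fj0)//; have := vA j; rewrite mxE.
have wjE : Normc.normc (w 0 j) = f j * v 0 j.
  by rewrite /f divfK// gt_eqF.
move: h; rewrite !normcE -rmorphM !lecR wjE mulrA (mulrC _ (f j)) -mulrA.
rewrite ler_pM2l// ler_pM2r//.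
Qed.

End DominatedSpectrum.

(* [Q] will be continuity at a point, differentiability at a point, or the
   existence of a second-order expansion at 0. *)
Section DetClosure.
Context {R : realType} {X : Type} (Q : (X -> R) -> Prop).
Hypothesis Qc : forall c, Q (fun=> c).
Hypothesis QD : forall f g, Q f -> Q g -> Q (fun x => f x + g x).
Hypothesis QM : forall f g, Q f -> Q g -> Q (fun x => f x * g x).

Lemma closed_sum (I : Type) (r : seq I) (p : pred I) (F : I -> X -> R) :
  (forall i, Q (F i)) -> Q (fun x => \sum_(i <- r | p i) F i x).
Proof.
move=> QF; elim: r => [|i r IH].
  by under eq_fun do rewrite big_nil; exact: Qc.
under eq_fun do rewrite big_cons.
by case: (p i) => //; apply: QD.
Qed.

Lemma closed_prod (I : Type) (r : seq I) (p : pred I) (F : I -> X -> R) :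
  (forall i, Q (F i)) -> Q (fun x => \prod_(i <- r | p i) F i x).
Proof.
move=> QF; elim: r => [|i r IH].
  by under eq_fun do rewrite big_nil; exact: Qc.
under eq_fun do rewrite big_cons.
by case: (p i) => //; apply: QM.
Qed.

Lemma closed_det n (B : X -> 'M[R]_n) :
  (forall i j, Q (fun x => B x i j)) -> Q (fun x => \det (B x)).
Proof.
move=> QB; apply: closed_sum => s; apply: QM; first exact: Qc.
exact: closed_prod.
Qed.

Lemma closed_adj n (B : X -> 'M[R]_n) :
  (forall i j, Q (fun x => B x i j)) -> forall i j, Q (fun x => (\adj (B x)) i j).
Proof.
move=> QB i j; under eq_fun do rewrite mxE.
apply: QM; first exact: Qc.
by apply: closed_det => k l; under eq_fun do rewrite !mxE; exact: QB.
Qed.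

End DetClosure.

(** * Fixed vectors of an irreducible column-stochastic matrix *)

Section StationarySign.
Context {R : realType} {n : nat}.
Variable W : 'M[R]_n.
Hypothesis W0 : forall i j, 0 <= W i j.
Hypothesis W1 : forall j, \sum_i W i j = 1.
Hypothesis Wirr : forall i j, exists k, 0 < (W ^+ k) i j.

Lemma stationary_pow (u : 'cV[R]_n) k : W *m u = u -> W ^+ k *m u = u.
Proof.
move=> Wu; elim: k => [|k IH]; first by rewrite expr0 mul1mx.
by rewrite exprSr -mulmxA Wu.
Qed.

Lemma pow_ge0 k i j : 0 <= (W ^+ k) i j.
Proof.
elim: k i j => [|k IH] i j; first by rewrite expr0 mxE ler0n.
by rewrite exprS mxE sumr_ge0// => l _; rewrite mulr_ge0.
Qed.

(** If (W^k)(i,j) > 0, then u_i = (W^k u)_i is at least (W^k)(i,j) u_j. *)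
Lemma stationary_pos (u : 'cV[R]_n) (j : 'I_n) : (forall i, 0 <= u i 0) ->
  W *m u = u -> 0 < u j 0 -> forall i, 0 < u i 0.
Proof.
move=> u0 Wu uj i; have [k Wk] := Wirr i j.
rewrite -(stationary_pow k Wu) mxE (bigD1 j)//= ltr_pwDl ?mulr_gt0//.
by rewrite sumr_ge0// => l _; rewrite mulr_ge0// pow_ge0.
Qed.

(** The triangle inequality gives |u| <= W|u| entrywise, and unit column sums give both sides the
    same total, so no entry can be strict. *)
Lemma stationary_norm (u : 'cV[R]_n) : W *m u = u ->
  W *m (\col_i `|u i 0|) = \col_i `|u i 0|.
Proof.
move=> Wu; set a := \col_i _.
have le i : a i 0 <= (W *m a) i 0.
  rewrite !mxE -{1}Wu mxE (le_trans (ler_norm_sum _ _ _))// ler_sum// => j _.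
  by rewrite normrM ger0_norm// mxE.
have eqs : \sum_i (W *m a) i 0 = \sum_i a i 0.
  under eq_bigr do rewrite mxE.
  rewrite exchange_big; apply: eq_bigr => j _.
  by rewrite -mulr_suml W1 mul1r.
have : \sum_i ((W *m a) i 0 - a i 0) == 0 by rewrite sumrB eqs subrr.
rewrite psumr_eq0 => [/allP h|i _]; last by rewrite subr_ge0.
apply/matrixP => i j; rewrite ord1; apply/eqP; rewrite -subr_eq0.
exact: (h i (mem_index_enum _)).
Qed.

(* The positive and the negative part of a fixed vector are both fixed, hence
   each is everywhere positive or zero. *)
Lemma stationary_eq0 (u : 'cV[R]_n) :
  W *m u = u -> \sum_i u i 0 = 0 -> u = 0.
Proof.
move=> Wu su.
pose a := \col_i `|u i 0|.
have Wa : W *m a = a by exact: stationary_norm.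
have aE i : a i 0 = `|u i 0| by rewrite mxE.
have pos (s : R) (sE : s = 1 \/ s = -1) : (exists j, 0 < s * u j 0) ->
    forall i, 0 < s * u i 0.
  (* [p] is twice the positive part of [s *: u], and it is fixed because [a] and [u] are. *)
  move=> [j suj] i; pose p := a + s *: u.
  have pE k : p k 0 = `|u k 0| + s * u k 0 by rewrite !mxE.
  have p0 k : 0 <= p k 0.
    rewrite pE; case: sE => ->; have := ler_norm (u k 0);
      have := ler_norm (- u k 0); rewrite normrN; lra.
  have Wp : W *m p = p by rewrite mulmxDr Wa -scalemxAr Wu.
  have pj : 0 < p j 0 by rewrite pE ltr_wpDl.
  have := stationary_pos p0 Wp pj i; rewrite pE.
  by case: sE => ->; case: (ler0P (u i 0)) => ? ?; lra.
have [/existsP[j]|/existsPn z] := boolP [exists j, u j 0 != 0]; last first.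
  by apply/matrixP => i j; rewrite ord1 mxE; have := z i; rewrite negbK => /eqP.
rewrite neq_lt => /orP[] uj.
  have h := pos (-1) (or_intror erefl).
  have : 0 < \sum_i - 1 * u i 0.
    rewrite (bigD1 j)//= ltr_pwDl//; first by apply: h; exists j; lra.
    by apply: sumr_ge0 => i _; apply/ltW/h; exists j; lra.
  by rewrite -mulr_sumr su mulr0 ltxx.
have h := pos 1 (or_introl erefl).
have : 0 < \sum_i 1 * u i 0.
  rewrite (bigD1 j)//= ltr_pwDl//; first by apply: h; exists j; lra.
  by apply: sumr_ge0 => i _; apply/ltW/h; exists j; lra.
by rewrite -mulr_sumr su mulr0 ltxx.
Qed.

(* By Laplace expansion the column sum is the determinant of [1 - W] with
   row [y] replaced by ones. *)
Lemma col_sum_adj_neq0 (y : 'I_n) : \sum_x (\adj (1%:M - W)) x y != 0.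
Proof.
pose C := \matrix_(i, j) (if i == y then 1 else (1%:M - W) i j).
have -> : \sum_x (\adj (1%:M - W)) x y = \det C.
  rewrite (expand_det_row C y); apply: eq_bigr => x _.
  rewrite !mxE eqxx mul1r /cofactor; congr (_ * \det _).
  apply/matrixP => i j; rewrite !mxE [lift _ _ == y]eq_sym.
  by rewrite (negPf (neq_lift _ _)).
rewrite -det_tr; apply/negP => /det0P[v v0 vC].
have Cv : C *m v^T = 0 by rewrite -[C]trmxK -trmx_mul vC trmx0.
have sv : \sum_i v^T i 0 = 0.
  have := congr1 (fun M : 'cV_n => M y 0) Cv; rewrite !mxE; apply: etrans.
  by apply: eq_bigr => i _; rewrite !mxE eqxx mul1r.
have off i : i != y -> ((1%:M - W) *m v^T) i 0 = 0.
  move=> iy; have := congr1 (fun M : 'cV_n => M i 0) Cv; rewrite !mxE; apply: etrans.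
  by apply: eq_bigr => j _; rewrite !mxE (negPf iy).
(* The columns of 1 - W sum to zero, so the entries of the product do too; since all rows but [y]
   vanish, row [y] vanishes as well. *)
have tot : \sum_i ((1%:M - W) *m v^T) i 0 = 0.
  have E i : ((1%:M - W) *m v^T) i 0 = v^T i 0 - \sum_j W i j * v^T j 0.
    by rewrite mulmxBl mul1mx mxE [X in _ + X]mxE [X in _ - X]mxE.
  under eq_bigr do rewrite E.
  rewrite sumrB sv add0r; apply/eqP; rewrite oppr_eq0.
  rewrite exchange_big/=; under eq_bigr do rewrite -mulr_suml W1 mul1r.
  by rewrite sv.
have all0 : (1%:M - W) *m v^T = 0.
  apply/matrixP => i j; rewrite ord1 [RHS]mxE.
  have [->|/off//] := eqVneq i y.
  by move: tot; rewrite (bigD1 y)//= [X in _ + X]big1 ?addr0.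
have Wv : W *m v^T = v^T.
  by apply/esym/eqP; rewrite -subr_eq0 -{1}[v^T]mul1mx -mulmxBl all0.
have := stationary_eq0 Wv sv.
by move/(congr1 trmx); rewrite trmxK trmx0 => ve; rewrite ve eqxx in v0.
Qed.

(** Minimum principle: at a minimising index [m], v_m is the average of the v_x with weights
    (W^l)(x,m), so v_k = v_m whenever (W^l)(k,m) > 0, and irreducibility reaches every [k]. *)
Lemma left_fixed_const (v : 'rV[R]_n) : v *m W = v ->
  forall i j, v 0 i = v 0 j.
Proof.
move=> vW i j; pose m := [arg min_(k < i) v 0 k]%O.
have mP k : v 0 m <= v 0 k by rewrite /m; case: arg_minP => // l _; exact.
suff c k : v 0 k = v 0 m by rewrite !c.
have vWk l : v *m W ^+ l = v.
  by elim: l => [|l IH]; rewrite ?expr0 ?mulmx1// exprS mulmxA vW.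
have sW l : \sum_x (W ^+ l) x m = 1.
  elim: l => [|l IH]; first by rewrite expr0 (bigD1 m)//= mxE eqxx
    big1 ?addr0// => x /negPf xm; rewrite mxE xm.
  rewrite exprS -IH; under eq_bigr do rewrite mxE.
  by rewrite exchange_big; apply: eq_bigr => x _; rewrite -mulr_suml W1 mul1r.
have [l Wl] := Wirr k m.
have : \sum_x (v 0 x - v 0 m) * (W ^+ l) x m == 0.
  under eq_bigr do rewrite mulrBl.
  rewrite sumrB -mulr_sumr sW mulr1 subr_eq0; apply/eqP.
  by rewrite -[in RHS](vWk l) mxE.
rewrite psumr_eq0 => [/allP h|x _]; last first.
  by rewrite mulr_ge0 ?subr_ge0// pow_ge0.
have := h k (mem_index_enum _).
by rewrite /= mulf_eq0 (gt_eqF Wl) orbF subr_eq0 => /eqP.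
Qed.

End StationarySign.

Lemma continuous_near_gt0 (R : realType) (X : topologicalType) (f : X -> R) x :
  {for x, continuous f} -> 0 < f x -> \forall y \near x, 0 < f y.
Proof. by move=> cf; exact: cvgr_gt. Qed.

Lemma is_derive1_near_caratheodory (R : realType) (f q : R -> R) (x : R) :
  (\forall z \near x, f z - f x = q z * (z - x)) -> {for x, continuous q} ->
  is_derive x 1 f (q x).
Proof.
move=> fq cq; apply: (@near_eq_is_derive _ _ _ (fun z => f x + q z * (z - x))).
  by apply: filterS fq => z <-; rewrite addrC subrK.
apply/is_derive1_caratheodory; exists q; split=> // z.
by rewrite subrr mulr0 addr0 addrAC subrr add0r.
Qed.

Lemma is_derive1M (R : realType) (f h : R -> R) (x a b : R) :
  is_derive x 1 f a -> is_derive x 1 h b ->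
  is_derive x 1 (fun t => f t * h t) (a * h x + f x * b).
Proof.
move=> fa hb; have := is_deriveM fa hb; rewrite addrC.
by rewrite /GRing.scale/= (mulrC (h x)).
Qed.

Section MatrixProducts.
Context {R : realType} {X : Type} (Q : (X -> R) -> Prop).
Hypothesis Qc : forall c, Q (fun=> c).
Hypothesis QD : forall f g, Q f -> Q g -> Q (fun x => f x + g x).
Hypothesis QM : forall f g, Q f -> Q g -> Q (fun x => f x * g x).

Lemma closed_mulmx m n p (a : X -> 'M[R]_(m, n)) (b : X -> 'M[R]_(n, p)) :
  (forall i j, Q (fun x => a x i j)) -> (forall i j, Q (fun x => b x i j)) ->
  forall i j, Q (fun x => (a x *m b x) i j).
Proof.
move=> Qa Qb i j; under eq_fun do rewrite mxE.
by apply: closed_sum => // k; apply: QM.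
Qed.

End MatrixProducts.

(** * Adjugate eigenvectors of the tilted matrix and their regularity *)

Section TiltedMatrix.
Context {R : realType} {n : nat}.
Variables (w g : 'M[R]_n).

Definition tilt (t : R) : 'M[R]_n := \matrix_(i, j) (w i j * expR (t * g i j)).

(** The argument is the pair (theta, lambda). *)
Definition charmx (p : R * R) : 'M[R]_n := p.2%:M - tilt p.1.

(** Column sums of the adjugate. At a root of the determinant they form a left eigenvector unless
    they vanish; being polynomial in the entries of [charmx], they inherit the regularity of those
    entries. *)
Definition lvec (p : R * R) : 'rV[R]_n := const_mx 1 *m \adj (charmx p).

Definition rvec (p : R * R) : 'cV[R]_n := \adj (charmx p) *m const_mx 1.

Lemma lvec_charmx p : lvec p *m charmx p = \det (charmx p) *: const_mx 1.
Proof. by rewrite /lvec -mulmxA mul_adj_mx scalar_mxC mul_scalar_mx. Qed.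

Lemma charmx_rvec p : charmx p *m rvec p = \det (charmx p) *: const_mx 1.
Proof. by rewrite /rvec mulmxA mul_mx_adj mul_scalar_mx. Qed.

Lemma lvec_tilt p : \det (charmx p) = 0 -> lvec p *m tilt p.1 = p.2 *: lvec p.
Proof.
move=> d0; have := lvec_charmx p; rewrite d0 scale0r /charmx mulmxBr.
by move/eqP; rewrite subr_eq0 => /eqP <-; rewrite scalar_mxC mul_scalar_mx.
Qed.

Lemma tilt_rvec p : \det (charmx p) = 0 -> tilt p.1 *m rvec p = p.2 *: rvec p.
Proof.
move=> d0; have := charmx_rvec p; rewrite d0 scale0r /charmx mulmxBl.
by move/eqP; rewrite subr_eq0 => /eqP <-; rewrite mul_scalar_mx.
Qed.

Lemma charmxE p i j :
  charmx p i j = p.2 *+ (i == j) - w i j * expR (p.1 * g i j).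
Proof. by rewrite !mxE. Qed.

Section Closed.
Context {X : Type} (Q : (X -> R) -> Prop).
Hypothesis Qc : forall c, Q (fun=> c).
Hypothesis QD : forall f g, Q f -> Q g -> Q (fun x => f x + g x).
Hypothesis QM : forall f g, Q f -> Q g -> Q (fun x => f x * g x).
Variables (p : X -> R * R).
Hypothesis Q2 : Q (fun x => (p x).2).
Hypothesis Qe : forall c, Q (fun x => expR ((p x).1 * c)).

Lemma closed_charmx i j : Q (fun x => charmx (p x) i j).
Proof.
under eq_fun do rewrite charmxE -mulr_natr -mulNr.
by apply: QD; apply: QM.
Qed.

Lemma closed_det_charmx : Q (fun x => \det (charmx (p x))).
Proof. by apply: closed_det => // i j; exact: closed_charmx. Qed.

Lemma closed_lvec i : Q (fun x => lvec (p x) 0 i).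
Proof.
under eq_fun do rewrite mxE.
apply: closed_sum => // j; under eq_fun do rewrite mxE.
by apply: QM => //; apply: closed_adj => // k l; exact: closed_charmx.
Qed.

Lemma closed_rvec i : Q (fun x => rvec (p x) i 0).
Proof.
under eq_fun do rewrite mxE.
apply: closed_sum => // j; under eq_fun do rewrite [const_mx _ _ _]mxE.
by apply: QM => //; apply: closed_adj => // k l; exact: closed_charmx.
Qed.

End Closed.

Section Continuity.
Context {X : topologicalType} (p : X -> R * R) (x : X).
Hypothesis p1 : {for x, continuous (fun x => (p x).1)}.
Hypothesis p2 : {for x, continuous (fun x => (p x).2)}.

Let Q (f : X -> R) : Prop := f y @[y --> x] --> f x.
Let Qc c : Q (fun=> c). Proof. exact: cvg_cst. Qed.
Let QD f h : Q f -> Q h -> Q (fun x => f x + h x).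
Proof. by move=> *; apply: cvgD. Qed.
Let QM f h : Q f -> Q h -> Q (fun x => f x * h x).
Proof. by move=> *; apply: cvgM. Qed.
Let Qe c : Q (fun x => expR ((p x).1 * c)).
Proof.
apply: (@continuous_comp _ _ _ (fun x => (p x).1 * c) expR); last exact: continuous_expR.
by apply: QM.
Qed.

Lemma continuous_det_charmx : {for x, continuous (fun x => \det (charmx (p x)))}.
Proof. exact: (@closed_det_charmx _ Q). Qed.

Lemma continuous_lvec i : {for x, continuous (fun x => lvec (p x) 0 i)}.
Proof. exact: (@closed_lvec _ Q). Qed.

Lemma continuous_rvec i : {for x, continuous (fun x => rvec (p x) i 0)}.
Proof. exact: (@closed_rvec _ Q). Qed.

Lemma continuous_lvec_rvec :
  {for x, continuous (fun x => (lvec (p x) *m rvec (p x)) 0 0)}.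
Proof.
apply: (@closed_mulmx _ _ Q) => // i j.
  by rewrite ord1; exact: continuous_lvec.
by rewrite ord1; exact: continuous_rvec.
Qed.

End Continuity.

End TiltedMatrix.

(** * The Perron-Frobenius eigenvalue near theta = 0 *)

Section Perturbation.
Context {R : realType} {n : nat}.
Variables (w g : 'M[R]_n) (lam : R -> R) (y : 'I_n).
Hypothesis w0 : forall i j, 0 <= w i j.
Hypothesis w1 : forall j, \sum_i w i j = 1.
Hypothesis wirr : forall i j, exists k, 0 < (w ^+ k) i j.
Hypothesis lamE : forall t r, eigenvalue (tilt w g t) r ->
  (forall z : R[i], eigenvalue (map_mx (real_complex R) (tilt w g t)) z ->
     `|z| <= (r%:C)%C) -> lam t = r.

Local Notation tilt := (tilt w g).
Local Notation chi p := (\det (charmx w g p)).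
Local Notation lvec := (lvec w g).
Local Notation rvec := (rvec w g).

Lemma tilt0 : tilt 0 = w.
Proof. by apply/matrixP => i j; rewrite mxE mul0r expR0 mulr1. Qed.

Lemma tilt_ge0 t i j : 0 <= tilt t i j.
Proof. by rewrite mxE mulr_ge0// expR_ge0. Qed.

Lemma charmx01 : charmx w g (0, 1) = 1%:M - w.
Proof. by rewrite /charmx tilt0. Qed.

(** The all-ones row is a left eigenvector of [charmx w g (0, l)] for [l - 1]; multiplying by the
    adjugate splits off this factor. It yields both the root at 1 and the sign change across it. *)
Lemma chi0 l x : chi (0, l) = (l - 1) * lvec (0, l) 0 x.
Proof.
pose one : 'rV[R]_n := const_mx 1.
have h : one *m charmx w g (0, l) = (l - 1) *: one.
  rewrite /charmx tilt0 mulmxBr scalar_mxC mul_scalar_mx scalerBl scale1r.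
  congr (_ - _); apply/matrixP => i j; rewrite !mxE -[RHS](w1 j).
  by apply: eq_bigr => k _; rewrite mxE mul1r.
have : one *m (charmx w g (0, l) *m \adj (charmx w g (0, l))) =
    (l - 1) *: lvec (0, l) by rewrite mulmxA h -scalemxAl.
rewrite mul_mx_adj scalar_mxC mul_scalar_mx => /(congr1 (fun M : 'rV__ => M 0 x)).
by rewrite !mxE mulr1.
Qed.

Lemma chi01 : chi (0, 1) = 0.
Proof. by rewrite (chi0 1 y) subrr mul0r. Qed.

(** The common entry of the left eigenvector at (0, 1). By [chi0] it is also the derivative at 1 of
    the characteristic polynomial of [w], so [q0 != 0] says that the root is simple. *)
Definition q0 := lvec (0, 1) 0 y.

Lemma lvec01 x : lvec (0, 1) 0 x = q0.
Proof.
apply: (left_fixed_const w0 w1 wirr).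
by have := lvec_tilt chi01; rewrite /= tilt0 scale1r.
Qed.

Lemma q0_neq0 : q0 != 0.
Proof.
rewrite /q0 mxE; under eq_bigr do rewrite mxE mul1r.
by rewrite charmx01; exact: col_sum_adj_neq0.
Qed.

(* The sign factor [q0] makes the left eigenvector positive. *)
Definition good_point (p : R * R) :=
  (forall x, 0 < q0 * lvec p 0 x) /\ 0 < (lvec p *m rvec p) 0 0.

Lemma good_point01 : good_point (0, 1).
Proof.
have q2 : 0 < q0 * q0 by rewrite -expr2 exprn_even_gt0//= q0_neq0.
split=> [x|]; first by rewrite lvec01.
have lE : lvec (0, 1) = q0 *: const_mx 1.
  by apply/matrixP => i j; rewrite ord1 lvec01 !mxE mulr1.
(* With [lvec (0, 1)] equal to q0 times the ones row, the product is q0 times the sum of all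
   adjugate entries, which is again q0 times the sum of a ones vector. *)
have -> : lvec (0, 1) *m rvec (0, 1) = (q0 * q0) *: ((const_mx 1 : 'rV_n) *m const_mx 1).
  rewrite lE -scalemxAl /rvec mulmxA -/(lvec (0, 1)) lE -scalemxAl scalerA//.
rewrite mxE mulr_gt0// mxE (bigD1 y)//= !mxE mulr1 ltr_pwDl//.
by rewrite sumr_ge0// => i _; rewrite !mxE mulr1.
Qed.

Lemma fst_continuous (p : R * R) : {for p, continuous (fun q : R * R => q.1)}.
Proof. exact: cvg_fst. Qed.

Lemma snd_continuous (p : R * R) : {for p, continuous (fun q : R * R => q.2)}.
Proof. exact: cvg_snd. Qed.

Lemma good_point_near : \forall p \near ((0 : R), (1 : R)), good_point p.
Proof.
have [p1 p2] := good_point01.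
have c1 := @fst_continuous (0, 1); have c2 := @snd_continuous (0, 1).
have c3 : {for ((0 : R), (1 : R)),
    continuous (fun p : R * R => (lvec p *m rvec p) 0 0)}.
  exact: continuous_lvec_rvec.
apply: filterI; last first.
  exact: (continuous_near_gt0 c3).
have FF : Filter (nbhs ((0 : R), (1 : R))) by exact: nbhs_filter.
apply: (filter_forall FF) => x.
have cx : {for ((0 : R), (1 : R)), continuous (fun p : R * R => q0 * lvec p 0 x)}.
  by apply: cvgMl_tmp; apply: continuous_lvec.
exact: (continuous_near_gt0 cx).
Qed.

Definition good_root t l := chi (t, l) = 0 /\ good_point (t, l).

(** The positive left eigenvector at [t] is the test vector, but for the matrix at [s]: taking
    [s = t] shows that a good root dominates the spectrum, and [s <> t] compares eigenvalues at
    different parameters. *)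
Lemma good_root_norm_le t l (s c : R) (z : R[i]) : good_root t l ->
  (forall j, (lvec (t, l) *m tilt s) 0 j * q0 <= c * (q0 * lvec (t, l) 0 j)) ->
  eigenvalue (map_mx (real_complex R) (tilt s)) z -> `|z| <= (c%:C)%C.
Proof.
move=> [_ [lp _]] h ez.
apply: (@norm_eigenvalue_le _ _ (tilt s) (q0 *: lvec (t, l))) ez.
- exact: tilt_ge0.
- by move=> j; rewrite mxE.
- by move=> j; rewrite -scalemxAl mxE [X in _ <= _ * X]mxE mulrC; exact: h.
Qed.

Lemma good_root_eigenvalue t l : good_root t l -> eigenvalue (tilt t) l.
Proof.
move=> [c0 [lp _]]; apply/eigenvalueP; exists (lvec (t, l)).
  exact: (lvec_tilt c0).
by apply/rV0Pn; exists y; have := lp y; case: eqP => // ->; rewrite mulr0 ltxx.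
Qed.

Lemma good_root_lam t l : good_root t l -> lam t = l.
Proof.
move=> tl; apply: lamE; first exact: good_root_eigenvalue.
move=> z; apply: (good_root_norm_le tl) => j.
by have [c0 _] := tl; rewrite (lvec_tilt c0) mxE/= mulrAC -mulrA.
Qed.

(** By [chi0] and positivity of the left vector, [q0 * chi (0, l)] is negative at 1 - r and positive
    at 1 + r. Both strict signs persist for [t] near 0, and the intermediate value theorem in [l]
    gives the root. *)
Lemma root_near (e : R) : 0 < e ->
  \forall t \near (0 : R), exists2 l, `|l - 1| <= e & good_root t l.
Proof.
move=> e0.
have /nbhs_ballP[d /= d0 dP] := good_point_near.
(* This radius keeps the root within [e] of 1 and the segment inside the ball of good points. *)
pose r := Num.min e (d / 2).
have r0 : 0 < r by rewrite lt_min e0 divr_gt0.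
have rd : r < d.
  by rewrite gt_min orbC ltr_pdivrMr// ltr_pMr// ltr1n.
have re : r <= e by rewrite ge_min lexx.
have G t l : `|t| < d -> `|l - 1| <= r -> good_point (t, l).
  move=> td lr; apply: dP; split; rewrite /= /ball/= ?sub0r ?normrN//.
  by rewrite distrC (le_lt_trans lr).
have cchi t l : {for t, continuous (fun t => q0 * chi (t, l))}.
  apply: cvgMl_tmp; apply: continuous_det_charmx; first exact: cvg_id.
  exact: cvg_cst.
have cchi2 t l : {for l, continuous (fun l => q0 * chi (t, l))}.
  apply: cvgMl_tmp; apply: continuous_det_charmx; last exact: cvg_id.
  exact: cvg_cst.
have vp (s : R) : `|s| <= r -> 0 < q0 * lvec (0, 1 + s) 0 y.
  by move=> sr; have [] := G 0 (1 + s); rewrite ?normr0// addrAC subrr add0r.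
have hp : \forall t \near (0 : R), 0 < q0 * chi (t, 1 + r).
  apply: (cvgr_gt _ (cchi 0 (1 + r))).
  rewrite (chi0 _ y) mulrCA mulr_gt0//; first by lra.
  by apply: vp; rewrite gtr0_norm.
have hm : \forall t \near (0 : R), q0 * chi (t, 1 - r) < 0.
  apply: (cvgr_lt _ (cchi 0 (1 - r))).
  rewrite (chi0 _ y) mulrCA nmulr_rlt0//; last by lra.
  by apply: vp; rewrite normrN gtr0_norm.
have ht : \forall t \near (0 : R), `|t| < d.
  apply/nbhs_ballP; exists d => // t; rewrite /ball/= sub0r normrN//.
near=> t.
have tp : 0 < q0 * chi (t, 1 + r) by near: t.
have tm : q0 * chi (t, 1 - r) < 0 by near: t.
have td : `|t| < d by near: t.
have [|||l lr l0] := @IVT R (fun l => q0 * chi (t, l)) (1 - r) (1 + r) 0.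
- lra.
- by apply: continuous_subspaceT => l; exact: cchi2.
- by rewrite ge_min le_max (ltW tm) (ltW tp) orbT.
have lr' : `|l - 1| <= r by move: lr; rewrite in_itv/= ler_norml; lra.
exists l; first exact: le_trans re.
split; last exact: G.
by move/eqP: l0; rewrite mulf_eq0 (negPf q0_neq0) => /eqP.
Unshelve. all: by end_near.
Qed.

Definition good t := good_root t (lam t).

Lemma good_near : \forall t \near (0 : R), good t.
Proof.
have := root_near ltr01; apply: filterS => t [l _ tl].
by rewrite /good (good_root_lam tl).
Qed.

Lemma lam0 : lam 0 = 1.
Proof. by apply: good_root_lam; split; [exact: chi01|exact: good_point01]. Qed.

Lemma lam_near_gt0 : \forall t \near (0 : R), 0 < lam t.
Proof.
have e0 : (0 : R) < 2^-1 by rewrite invr_gt0.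
have := root_near e0; apply: filterS => t [l h tl].
by rewrite (good_root_lam tl); move: h; rewrite ler_norml; lra.
Qed.

Definition gmax : R := \sum_i \sum_j `|g i j|.

Lemma gmax_ge i j : `|g i j| <= gmax.
Proof.
rewrite /gmax (bigD1 i)//= (bigD1 j)//= -addrA lerDl addr_ge0//.
  exact: sumr_ge0.
by apply: sumr_ge0 => k _; exact: sumr_ge0.
Qed.

Lemma tilt_le t s i j : tilt t i j <= expR (gmax * `|t - s|) * tilt s i j.
Proof.
rewrite !mxE mulrCA ler_wpM2l// -expRD ler_expR -lerBlDr -mulrBl.
rewrite (le_trans (ler_norm _))// normrM mulrC ler_wpM2r// gmax_ge//.
Qed.

(* Monotonicity of the Perron-Frobenius eigenvalue, tested on the positive
   left eigenvector at [s]. *)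
Lemma lam_le t s : good t -> good s ->
  lam t <= expR (gmax * `|t - s|) * lam s.
Proof.
move=> gt gs.
have : `|((lam t)%:C)%C| <= ((expR (gmax * `|t - s|) * lam s)%:C)%C.
  apply: (good_root_norm_le (s := t) gs) => [j|]; last first.
    by rewrite eigenvalue_map; exact: (good_root_eigenvalue gt).
  have [c0 [lp _]] := gs.
  rewrite -mulrA (mulrC _ q0); have -> : lam s * (q0 * lvec (s, lam s) 0 j) =
      \sum_i q0 * lvec (s, lam s) 0 i * tilt s i j.
    under eq_bigr do rewrite -mulrA.
    rewrite -mulr_sumr mulrCA; congr (_ * _).
    by have := congr1 (fun M : 'rV__ => M 0 j) (lvec_tilt c0); rewrite /= !mxE.
  rewrite mxE !mulr_sumr; apply: ler_sum => i _.
  rewrite [leLHS]mulrA [leRHS]mulrCA ler_wpM2l ?(ltW (lp i))//.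
  exact: tilt_le.
rewrite normc_def /= expr0n /= addr0 sqrtr_sqr lecR.
exact: le_trans (ler_norm _).
Qed.

(** Using [lam_le] in both directions squeezes [lam t] between [expR (- gmax * |t - s|) * lam s] and
    [expR (gmax * |t - s|) * lam s]. *)
Lemma lam_continuous s : (\forall t \near s, good t) -> {for s, continuous lam}.
Proof.
move=> gs; have gs0 := nbhs_singleton gs.
have ce (c : R) : expR (c * `|t - s|) * lam s @[t --> s] --> lam s.
  rewrite -[X in _ --> X]mul1r -expR0 -(mulr0 c) -(normr0 R) -(subrr s).
  apply: cvgMr_tmp; apply: (@continuous_comp _ _ _ (fun t => c * `|t - s|) expR).
    by apply: cvgMl_tmp; apply: cvg_norm; apply: cvgB; [exact: cvg_id|exact: cvg_cst].
  exact: continuous_expR.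
apply: (squeeze_cvgr _ (ce (- gmax)) (ce gmax)).
apply: filterS gs => t gt; rewrite lam_le// andbT.
rewrite -(ler_pM2l (expR_gt0 (gmax * `|s - t|))) mulrA -expRD distrC.
by rewrite mulNr subrr expR0 mul1r distrC lam_le.
Qed.

Definition dtilt (t : R) : 'M[R]_n :=
  \matrix_(i, j) (w i j * g i j * expR (t * g i j)).

Lemma is_derive_expRM (c t : R) :
  is_derive t 1 (fun t => expR (t * c)) (c * expR (t * c)).
Proof.
have h : is_derive t 1 (fun t : R => t * c) c.
  have := is_derive1M (is_derive_id t 1) (is_derive_cst c t 1).
  by rewrite mul1r mulr0 addr0.
by rewrite mulrC; exact: (@is_derive1_comp _ expR (fun t => t * c)).
Qed.

Lemma is_derive_tilt i j (t : R) :
  is_derive t 1 (fun t => tilt t i j) (dtilt t i j).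
Proof.
rewrite (_ : (fun _ => _) = fun t => w i j * expR (t * g i j)); last first.
  by apply/funext => s; rewrite mxE.
rewrite mxE -mulrA; have h := is_derive_expRM (g i j) t.
by have := is_derive1M (is_derive_cst (w i j) t 1) h; rewrite mul0r add0r.
Qed.

Local Notation pt t := (t, lam t).

(** First-order perturbation formula l A' r / (l r) for a simple eigenvalue; the second clause of
    [good_point] keeps the denominator positive. *)
Definition dlam (t : R) : R :=
  (lvec (pt t) *m dtilt t *m rvec (pt t)) 0 0
    / (lvec (pt t) *m rvec (pt t)) 0 0.

(** Pairing the left eigenvector at [t] with the right eigenvector at [s] makes the difference
    formula exact, so differentiating [lam] requires only continuity of the eigenvectors. *)
Lemma lam_sub t s : good t -> good s ->
  (lam t - lam s) * (lvec (pt t) *m rvec (pt s)) 0 0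
  = (lvec (pt t) *m (tilt t - tilt s) *m rvec (pt s)) 0 0.
Proof.
move=> [ct _] [cs _]; rewrite mulmxBr mulmxBl (lvec_tilt ct).
rewrite -(mulmxA _ (tilt s)) (tilt_rvec cs) -scalemxAl -scalemxAr -scalerBl.
by rewrite [RHS]mxE.
Qed.

Lemma is_derive_lam s : (\forall t \near s, good t) ->
  is_derive s 1 lam (dlam s).
Proof.
move=> gs; have gs0 := nbhs_singleton gs.
have cl := lam_continuous gs.
have ex i j := (is_derive1_caratheodory _ _ _).1 (is_derive_tilt i j s).
(* Entrywise Carathéodory slopes: continuous at [s], with value [dtilt s] there. *)
pose q t : 'M[R]_n := \matrix_(i, j) projT1 (cid (ex i j)) t.
have tq t : tilt t - tilt s = (t - s) *: q t.
  apply/matrixP => i j; rewrite mxE [X in _ + X]mxE [RHS]mxE [q _ _ _]mxE.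
  by case: cid => Q /= [h _ _]; rewrite h mulrC.
have cq i j : {for s, continuous (fun t => q t i j)}.
  rewrite (_ : (fun _ => _) = projT1 (cid (ex i j))).
    by case: cid => Q /= [].
  by apply/funext => t; rewrite mxE.
have qs : q s = dtilt s.
  by apply/matrixP => i j; rewrite mxE; case: cid => Q /= [].
pose Q (f : R -> R) : Prop := f t @[t --> s] --> f s.
have Qc c : Q (fun=> c) by exact: cvg_cst.
have QD f h : Q f -> Q h -> Q (fun x => f x + h x) by move=> *; apply: cvgD.
have QM f h : Q f -> Q h -> Q (fun x => f x * h x) by move=> *; apply: cvgM.
have Ql i j : Q (fun t => lvec (pt t) i j).
  rewrite ord1.
  exact: (@continuous_lvec _ _ w g _ (fun t => (t, lam t)) s (@cvg_id _ _) cl j).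
pose D t := (lvec (pt t) *m rvec (pt s)) 0 0.
pose N t := (lvec (pt t) *m q t *m rvec (pt s)) 0 0.
have QDen : Q D by apply: closed_mulmx.
have QN : Q N by apply: closed_mulmx => // i j; apply: closed_mulmx.
have Ds : 0 < D s by have [_ []] := gs0.
have -> : dlam s = N s / D s by rewrite /dlam /N qs.
apply: (@is_derive1_near_caratheodory _ _ (fun t => N t / D t)); last first.
  by apply: cvgM => //; apply: cvgV => //; rewrite gt_eqF.
have Dpos := continuous_near_gt0 QDen Ds.
apply: filterS2 gs Dpos => t gt Dt.
apply: (mulIf (lt0r_neq0 Dt)); rewrite (lam_sub gt gs0).
rewrite tq -scalemxAr -scalemxAl mxE mulrAC (divfK (lt0r_neq0 Dt)).
by rewrite mulrC.
Qed.

Lemma is_derive_lam_near : \forall s \near (0 : R), is_derive (s : R) 1 lam (dlam s).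
Proof.
have := near_join good_near; apply: filterS => s; exact: is_derive_lam.
Qed.

(** Bootstrap: [dlam] is rational in [lam] and exponentials of multiples of [t], so the first
    derivative of [lam] at 0 already provides the second. *)
Lemma derivable_dlam : derivable dlam 0 1.
Proof.
have [lam' _] : is_derive (0 : R) 1 lam (dlam 0) by exact: is_derive_lam good_near.
pose Q (f : R -> R) := derivable f 0 1.
have Qc c : Q (fun=> c) by exact: derivable_cst.
have QD f h : Q f -> Q h -> Q (fun x => f x + h x) by exact: derivableD.
have QM f h : Q f -> Q h -> Q (fun x => f x * h x) by exact: derivableM.
have Qe c : Q (fun t => expR (t * c)).
  by have [] := is_derive_expRM c 0.
have Ql i j : Q (fun t => lvec (pt t) i j) by rewrite ord1; apply: closed_lvec.
have Qr i j : Q (fun t => rvec (pt t) i j) by rewrite ord1; apply: closed_rvec.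
have Qd i j : Q (fun t => dtilt t i j).
  by under eq_fun do rewrite mxE; exact: (QM _ _ (Qc _) (Qe _)).
have QN : Q (fun t => (lvec (pt t) *m dtilt t *m rvec (pt t)) 0 0).
  exact: (closed_mulmx Qc QD QM (closed_mulmx Qc QD QM Ql Qd) Qr).
have QDen : Q (fun t => (lvec (pt t) *m rvec (pt t)) 0 0).
  exact: (closed_mulmx Qc QD QM Ql Qr).
apply: (QM _ _ QN); apply: derivableV QDen.
by have [_ [_ /gt_eqF ->]] := nbhs_singleton good_near.
Qed.

End Perturbation.

(** * Calculus of second-order jets at 0 *)

Section SecondOrderJets.
Context {R : realType}.
Implicit Types (f h : R -> R).

(** [c] is the second derivative itself, without the Taylor factor 1/2, and the first derivative
    must exist on a neighbourhood of 0. *)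
Definition jet2 f (a b c : R) := exists f1 : R -> R,
  [/\ f 0 = a, \forall t \near (0 : R), is_derive (t : R) 1 f (f1 t),
      f1 0 = b & is_derive (0 : R) 1 f1 c].

Lemma jet2_cst (c : R) : jet2 (fun=> c) c 0 0.
Proof.
exists (fun=> 0); split=> //; last exact: is_derive_cst.
by apply: filterE => t; exact: is_derive_cst.
Qed.

Lemma jet2D f h a b c a' b' c' : jet2 f a b c -> jet2 h a' b' c' ->
  jet2 (fun t => f t + h t) (a + a') (b + b') (c + c').
Proof.
move=> [f1 [fa f1P fb fc]] [h1 [ha h1P hb hc]].
exists (fun t => f1 t + h1 t); rewrite fa fb ha hb; split=> //.
  by apply: filterS2 f1P h1P => t *; exact: is_deriveD.
exact: is_deriveD.
Qed.

Lemma jet2M f h a b c a' b' c' : jet2 f a b c -> jet2 h a' b' c' ->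
  jet2 (fun t => f t * h t) (a * a') (b * a' + a * b')
    (c * a' + 2 * (b * b') + a * c').
Proof.
move=> [f1 [fa f1P fb fc]] [h1 [ha h1P hb hc]].
have fd := nbhs_singleton f1P; have hd := nbhs_singleton h1P.
exists (fun t => f1 t * h t + f t * h1 t); rewrite fa fb ha hb; split=> //.
  by apply: filterS2 f1P h1P => t *; exact: is_derive1M.
have := is_deriveD (is_derive1M fc hd) (is_derive1M fd hc).
rewrite fa fb ha hb; set e := (X in is_derive _ _ _ X) => d.
by rewrite (_ : _ + _ = e); [exact: d|rewrite /e; ring].
Qed.

Lemma jet2_sum (I : finType) (f : I -> R -> R) (a b c : I -> R) :
  (forall i, jet2 (f i) (a i) (b i) (c i)) ->
  jet2 (fun t => \sum_i f i t) (\sum_i a i) (\sum_i b i) (\sum_i c i).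
Proof.
move=> H; elim: (index_enum I) => [|i r IH].
  by under eq_fun do rewrite big_nil; rewrite !big_nil; exact: jet2_cst.
by under eq_fun do rewrite big_cons; rewrite !big_cons; exact: jet2D.
Qed.

Lemma jet2_expRM (c : R) : jet2 (fun t => expR (t * c)) 1 c (c ^+ 2).
Proof.
exists (fun t => c * expR (t * c)); rewrite mul0r expR0 mulr1; split=> //.
  by apply: filterE => t; exact: is_derive_expRM.
have := is_derive1M (is_derive_cst c (0 : R) 1) (is_derive_expRM c 0).
by rewrite mul0r add0r mul0r expR0 mulr1.
Qed.

(** Serves to differentiate an identity valid near 0 twice, by computing the jet of each side. *)
Lemma jet2_unique f h a b c a' b' c' : (\forall t \near (0 : R), f t = h t) ->
  jet2 f a b c -> jet2 h a' b' c' -> [/\ a = a', b = b' & c = c'].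
Proof.
move=> fh [f1 [<- f1P <- fc]] [h1 [<- h1P <- hc]].
have f1h1 : \forall t \near (0 : R), f1 t = h1 t.
  apply: filterS3 (near_join fh) f1P h1P => t fht ft ht.
  have ft' : is_derive t 1 h (f1 t) by exact: near_eq_is_derive ft.
  by rewrite -(@derive_val _ _ _ _ _ _ _ ft') (@derive_val _ _ _ _ _ _ _ ht).
split; [exact: nbhs_singleton fh|exact: nbhs_singleton f1h1|].
have fc' : is_derive (0 : R) 1 h1 c by exact: near_eq_is_derive fc.
by rewrite -(@derive_val _ _ _ _ _ _ _ fc') (@derive_val _ _ _ _ _ _ _ hc).
Qed.

Lemma jet2_ln f b c : (\forall t \near (0 : R), 0 < f t) -> jet2 f 1 b c ->
  jet2 (fun t => ln (f t)) 0 b (c - b ^+ 2).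
Proof.
move=> f0 [f1 [fa f1P fb fc]].
exists (fun t => (f t)^-1 * f1 t); rewrite fa fb ln1 invr1 mul1r; split=> //.
  by apply: filterS2 f0 f1P => t ft; exact/is_derive1_comp/is_derive1_ln.
have fd := nbhs_singleton f1P.
have f0' : f 0 != 0 by rewrite fa oner_neq0.
have := is_derive1M (is_deriveV f0' fd) fc.
rewrite fa fb expr1n invr1 /GRing.scale/=; set e := (X in is_derive _ _ _ X) => d.
by rewrite (_ : _ - _ = e); [exact: d|rewrite /e; ring].
Qed.

End SecondOrderJets.

(** * Poisson equations from the differentiated eigenvalue equation *)

Section PoissonEquation.
Context {R : realType} {n : nat}.
Variables (w g : 'M[R]_n) (lam : R -> R) (y : 'I_n).
Hypothesis w0 : forall i j, 0 <= w i j.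
Hypothesis w1 : forall j, \sum_i w i j = 1.
Hypothesis wirr : forall i j, exists k, 0 < (w ^+ k) i j.
Hypothesis lamE : forall t r, eigenvalue (tilt w g t) r ->
  (forall z : R[i], eigenvalue (map_mx (real_complex R) (tilt w g t)) z ->
     `|z| <= (r%:C)%C) -> lam t = r.

Lemma jet2_lam : jet2 lam 1 (dlam w g lam 0) ('D_1 (dlam w g lam) 0).
Proof.
exists (dlam w g lam); split=> //.
- exact: (lam0 y w0 w1 wirr lamE).
- exact: (is_derive_lam_near y w0 w1 wirr lamE).
- by apply: DeriveDef => //; exact: (derivable_dlam y w0 w1 wirr lamE).
Qed.

(** Having a jet is closed under sums and products, so it passes from [lam] to the adjugate vector;
    dividing by [q0] makes the value at 0 the all-ones vector. *)
Lemma jet2_lvec i : exists b c,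
  jet2 (fun t => (q0 w g y)^-1 * lvec w g (t, lam t) 0 i) 1 b c.
Proof.
pose Q (f : R -> R) := exists a b c, jet2 f a b c.
have Qc c : Q (fun=> c) by do 3 eexists; exact: jet2_cst.
have QD f h : Q f -> Q h -> Q (fun x => f x + h x).
  by move=> [? [? [? F]]] [? [? [? H]]]; do 3 eexists; exact: jet2D F H.
have QM f h : Q f -> Q h -> Q (fun x => f x * h x).
  by move=> [? [? [? F]]] [? [? [? H]]]; do 3 eexists; exact: jet2M F H.
have Qe c : Q (fun t => expR (t * c)) by do 3 eexists; exact: jet2_expRM.
have Ql : Q lam by do 3 eexists; exact: jet2_lam.
have [a [b [c j]]] : Q (fun t => (q0 w g y)^-1 * lvec w g (t, lam t) 0 i).
  by apply: (QM); [exact: Qc|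
    exact: (@closed_lvec _ _ w g _ Q Qc QD QM (fun t => (t, lam t)) Ql Qe)].
exists b, c; suff <- : a = 1 by [].
case: j => f1 [<- _ _ _].
rewrite (lam0 y w0 w1 wirr lamE) (lvec01 g y w0 w1 wirr) mulVf//.
exact: q0_neq0.
Qed.

(* [h] and [f] are the first and a corrected second derivative at 0 of the
   normalised left eigenvector; the two equations are the first two
   derivatives of the eigenvalue equation, and [f] is chosen so that the second
   one expresses the conditional variance of the martingale increment. *)
Lemma poisson_solution : exists m kappa (h f : 'I_n -> R),
  [/\ jet2 (fun t => ln (lam t)) 0 m kappa,
     forall j, \sum_i w i j * (g i j - m + h i - h j) = 0 &
     forall j, \sum_i w i j * (g i j - m + h i - h j) ^+ 2
       = kappa + f j - \sum_i w i j * f i].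
Proof.
have /choice[h /choice[k hk]] := jet2_lvec.
set m := dlam w g lam 0; set l2 := 'D_1 (dlam w g lam) 0.
pose V i t := (q0 w g y)^-1 * lvec w g (t, lam t) 0 i.
have eqn j : \forall t \near (0 : R),
    \sum_i V i t * (w i j * expR (t * g i j)) = lam t * V j t.
  apply: filterS (good_near y w0 w1 wirr lamE) => t [ct _].
  have := congr1 (fun M : 'rV__ => (q0 w g y)^-1 * M 0 j) (lvec_tilt ct).
  rewrite /= mxE [X in _ = _ * X]mxE mulr_sumr mulrCA => <-.
  by apply: eq_bigr => i _; rewrite [tilt _ _ _ _ _]mxE /V -mulrA.
have jl j := jet2_sum (fun i =>
  jet2M (hk i) (jet2M (jet2_cst (w i j)) (jet2_expRM (g i j)))).
have jr j := jet2M jet2_lam (hk j).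
have e1 j : \sum_i w i j * (g i j + h i) = m + h j.
  have [_ + _] := jet2_unique (eqn j) (jl j) (jr j).
  have -> : m + h j = m * 1 + 1 * h j by ring.
  by move=> <-; apply: eq_bigr => i _; ring.
have e2 j : \sum_i w i j * (g i j ^+ 2 + 2 * g i j * h i + k i)
    = l2 + 2 * m * h j + k j.
  have [_ _] := jet2_unique (eqn j) (jl j) (jr j).
  have -> : l2 + 2 * m * h j + k j = l2 * 1 + 2 * (m * h j) + 1 * k j by ring.
  by move=> <-; apply: eq_bigr => i _; ring.
(* Since [lam 0 = 1], l2 - m^2 is the second derivative of [ln (lam t)] at 0. Subtracting h^2 from
   [k] supplies the square of h_i that the squared increment contains and [e2] does not. *)
exists m, (l2 - m ^+ 2), h, (fun i => k i - h i ^+ 2); split.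
- apply: jet2_ln; last exact: jet2_lam.
  exact: (lam_near_gt0 y w0 w1 wirr lamE).
- move=> j; have : \sum_i (w i j * (g i j + h i) - (m + h j) * w i j) = 0.
    by rewrite sumrB e1 -mulr_sumr w1 mulr1 subrr.
  by apply: etrans; apply: eq_bigr => i _; ring.
(* Expands the square as ((g + h_i) - (m + h_j))^2, arranged so that [e2], [e1] and the unit column
   sums apply term by term. *)
- move=> j; transitivity (\sum_i (w i j * (g i j ^+ 2 + 2 * g i j * h i + k i)
    - w i j * (k i - h i ^+ 2) - 2 * (m + h j) * (w i j * (g i j + h i))
    + (m + h j) ^+ 2 * w i j)).
    by apply: eq_bigr => i _; ring.
  rewrite big_split/= !sumrB -!mulr_sumr e1 e2 w1; ring.
Qed.

End PoissonEquation.

(** The cross term is controlled with a free weight [t]: fixing [t] small in terms of [e] leaves a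
    bound n e/2 plus a constant, and dividing by [n] removes the constant. *)
Lemma cvg_quadratic_remainder (R : realType) (kappa B : R) (u r z : nat -> R) :
  (forall n, (0 < n)%N -> u n = kappa + n%:R^-1 * (r n + 2 * z n)) ->
  (forall n, `|r n| <= B) ->
  (forall n (t : R), 0 < t ->
    `|2 * z n| <= t * (n%:R * kappa + B) + t^-1 * B) ->
  u n @[n --> \oo] --> kappa.
Proof.
move=> uE rB zB; apply/cvgrPdist_le => e e0.
have k1 : 0 < `|kappa| + 1 by rewrite ltr_wpDl.
(* Makes [t * kappa] at most e/2; the added 1 keeps the denominator positive when [kappa] is 0. *)
pose t := e / 2 / (`|kappa| + 1).
have t0 : 0 < t by rewrite !divr_gt0.
have B0 : 0 <= B := le_trans (normr_ge0 _) (rB 0%N).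
pose C := t * B + t^-1 * B + B.
near=> n.
have n0 : (0 < n)%N by near: n; exact: nbhs_infty_gt.
have nR : 0 < n%:R :> R by rewrite ltr0n.
have nC : C / (e / 2) <= n%:R by near: n; exact: nbhs_infty_ger.
rewrite uE// opprD addrA subrr add0r normrN normrM ger0_norm ?invr_ge0//.
rewrite ler_pdivrMl// (le_trans (ler_normD _ _))//.
have h1 := zB n t t0; have h2 := rB n.
have h3 : C <= n%:R * (e / 2) by rewrite -ler_pdivrMr// divr_gt0.
have h4 : t * kappa <= e / 2.
  rewrite (le_trans (ler_wpM2l (ltW t0) (ler_norm kappa)))//.
  rewrite (@le_trans _ _ (t * (`|kappa| + 1)))//.
    by rewrite ler_wpM2l ?(ltW t0)// lerDl.
  by rewrite /t divfK// gt_eqF.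
have h5 : n%:R * (t * kappa) <= n%:R * (e / 2) by rewrite ler_wpM2l.
rewrite mulrDr (mulrCA t) in h1.
rewrite /C in h3; lra.
Unshelve. all: by end_near.
Qed.

(** * Expectations of finitely valued variables *)

Section FiniteExpectation.
Context {d : measure_display} {T : measurableType d} {R : realType}.
Variable P : probability T R.

Lemma expectation_finite (U : finType) (Z : T -> U) (F : U -> R) :
  (forall u, measurable (Z @^-1` [set u])) ->
  'E_P[F \o Z]%E = (\sum_u F u * fine (P (Z @^-1` [set u])))%:E.
Proof.
move=> mZ; rewrite unlock.
under eq_integral => t _.
  rewrite (_ : ((F \o Z) t)%:E =
    (\sum_u ((F u)%:E * (\1_(Z @^-1` [set u]) t)%:E))%E); last first.
    rewrite (bigD1 (Z t))//= big1 ?adde0 => [|u uZ].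
      by rewrite indicE mem_set// mule1.
    rewrite indicE memNset ?mule0//= => Zu.
    by move/eqP: uZ; apply; rewrite Zu.
  over.
rewrite integral_sum//=; last first.
  by move=> u; apply: integrableZl => //; exact: integrable_indic.
rewrite -sumEFin; apply: eq_bigr => u _.
rewrite integralZl//; last exact: integrable_indic.
by rewrite integral_indic// setIT EFinM fineK// fin_num_measure.
Qed.

End FiniteExpectation.

(** * The Markov property in integrated form *)

Section MarkovExpectation.
Context {d : measure_display} {T : measurableType d} {R : realType}.
Variable P : probability T R.
Context {S : finType}.
Variables (W : S -> S -> R) (X : nat -> T -> S).
Hypothesis XW : markov_process P W X.

(** Adaptedness as functional dependence on X_0, ..., X_n. With finite [S] such a variable factors
    through a finite set, which gives measurability and integrability. *)
Definition adapted n (Y : T -> R) :=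
  forall a b, (forall i, (i <= n)%N -> X i a = X i b) -> Y a = Y b.

Definition history n (t : T) : {ffun 'I_n.+1 -> S} := [ffun i : 'I_n.+1 => X i t].

Lemma history_preimage n (s : {ffun 'I_n.+1 -> S}) :
  history n @^-1` [set s] =
  [set t | forall i, (i <= n)%N -> X i t = s (inord i)].
Proof.
apply/seteqP; split=> t /=.
  by move=> <- i ni; rewrite ffunE inordK.
by move=> h; apply/ffunP => i; rewrite ffunE h ?inord_val// -ltnS.
Qed.

Lemma measurable_history n (s : {ffun 'I_n.+1 -> S}) :
  measurable (history n @^-1` [set s]).
Proof.
rewrite history_preimage.
rewrite (_ : [set _ | _] =
  \bigcap_(i in [set i | (i <= n)%N]) (X i @^-1` [set s (inord i)])).
  by apply: bigcap_measurable => [|i _]; [exists 0%N|exact: XW.1].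
by apply/seteqP; split=> t /= h i; apply: h.
Qed.

Lemma adapted_history n Y : adapted n Y ->
  exists F : {ffun 'I_n.+1 -> S} -> R, Y = F \o history n.
Proof.
move=> aY.
(* The value 0 is used only on histories that no sample point realises. *)
pose F s := if pselect (exists t, history n t = s) is left h
  then Y (projT1 (cid h)) else 0.
exists F; apply/funext => t; rewrite /F /=.
case: pselect => [h|[]]; last by exists t.
case: cid => a /= ha; apply: aY => i ni.
by have := congr1 (fun s : {ffun 'I_n.+1 -> S} => s (inord i)) ha; rewrite !ffunE inordK.
Qed.

Definition mean (Y : T -> R) : R := fine 'E_P[Y]%E.

Definition past_weight n (s : {ffun 'I_n.+1 -> S}) : R :=
  fine (P (history n @^-1` [set s])).

Lemma mean_history n F :
  mean (F \o history n) = \sum_s F s * past_weight s.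
Proof. by rewrite /mean (expectation_finite _ _ (@measurable_history n)). Qed.

Lemma expectation_adapted n Y : adapted n Y -> ('E_P[Y] = (mean Y)%:E)%E.
Proof.
move=> /adapted_history[F ->].
by rewrite mean_history (expectation_finite _ _ (@measurable_history n)).
Qed.

Lemma meanD n Y Z : adapted n Y -> adapted n Z ->
  mean (fun t => Y t + Z t) = mean Y + mean Z.
Proof.
move=> /adapted_history[F ->] /adapted_history[G ->].
rewrite (_ : (fun _ => _) = (fun s => F s + G s) \o history n)// !mean_history.
by rewrite -big_split; apply: eq_bigr => s _; rewrite mulrDl.
Qed.

Lemma meanZ n Y a : adapted n Y -> mean (fun t => a * Y t) = a * mean Y.
Proof.
move=> /adapted_history[F ->].
rewrite (_ : (fun _ => _) = (fun s => a * F s) \o history n)// !mean_history.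
by rewrite mulr_sumr; apply: eq_bigr => s _; rewrite mulrA.
Qed.

Lemma mean_cst a : mean (fun=> a) = a.
Proof. by rewrite /mean expectation_cst. Qed.

Lemma mean_ge0 Y : (forall t, 0 <= Y t) -> 0 <= mean Y.
Proof. by move=> Y0; rewrite fine_ge0// expectation_ge0. Qed.

Lemma mean_le n Y Z : adapted n Y -> adapted n Z ->
  (forall t, Y t <= Z t) -> mean Y <= mean Z.
Proof.
move=> aY aZ YZ; rewrite -subr_ge0 -mulN1r -(meanZ (-1) aY).
rewrite -(@meanD n)//; last by move=> a b /aY ->.
by apply: mean_ge0 => t; rewrite mulN1r subr_ge0.
Qed.

Lemma transition_weight n (s : {ffun 'I_n.+1 -> S}) x :
  fine (P ([set t | X n.+1 t = x] `&` history n @^-1` [set s])) =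
  W x (s ord_max) * past_weight s.
Proof.
rewrite /past_weight; set A := [set t | _]; set H := history n @^-1` _.
have mH : measurable H by exact: measurable_history.
have mA : measurable A by exact: (XW.1 n.+1 [set x]).
(* On a null past the Markov clause is silent, but both sides vanish. *)
have [P0|P0] := eqVneq (P H) 0%E.
  rewrite P0 mulr0; suff -> : P (A `&` H) = 0%E by [].
  by apply: (subset_measure0 _ mH) => //; exact: measurableI.
(* The Markov clause takes a whole sequence of states: [s] up to time n, then [x] from n+1 on. *)
pose y i := if (i <= n)%N then s (inord i) else x.
have HE : H = [set t | forall i, (i <= n)%N -> X i t = y i].
  rewrite /H history_preimage; apply/seteqP.
  by split=> t /= h i ni; rewrite h// /y ni.
have := XW.2 n y; rewrite /= -HE => /(_ P0).
rewrite /y ltnn leqnn (_ : inord n = ord_max); last first.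
  by apply/val_inj; rewrite /= inordK.
move=> <-; rewrite /cond_prob divfK// fine_eq0// fin_num_measure//.
Qed.

(** Tower property: [G] may be replaced by its conditional mean given the past. The proof sums over
    the joint law of X_{n+1} and the history. *)
Lemma mean_markov n Y (G : S -> S -> R) : adapted n Y ->
  mean (fun t => Y t * G (X n.+1 t) (X n t)) =
  mean (fun t => Y t * \sum_x W x (X n t) * G x (X n t)).
Proof.
move=> /adapted_history[F ->].
have hX t : X n t = history n t ord_max by rewrite ffunE.
pose Z t := (X n.+1 t, history n t).
pose K (p : S * {ffun 'I_n.+1 -> S}) := F p.2 * G p.1 (p.2 ord_max).
have ZE p : Z @^-1` [set p] =
    [set t | X n.+1 t = p.1] `&` history n @^-1` [set p.2].
  by case: p => x s; apply/seteqP; split=> t /=; [case=> -> ->|case=> <- <-].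
have mZ p : measurable (Z @^-1` [set p]).
  rewrite ZE; apply: measurableI; last exact: measurable_history.
  exact: (XW.1 n.+1 [set p.1]).
rewrite (_ : (fun _ => _) = K \o Z); last by apply/funext => t; rewrite /K /= hX.
rewrite {1}/mean (expectation_finite P K mZ) /=.
rewrite (_ : (fun _ => _) =
    (fun s => F s * \sum_x W x (s ord_max) * G x (s ord_max)) \o history n).
  2: by apply/funext => t; rewrite /= hX.
rewrite mean_history.
under eq_bigr do rewrite ZE transition_weight.
rewrite -(pair_bigA _ (fun x s => K (x, s) * (W x (s ord_max) * past_weight s)))/=.
rewrite exchange_big; apply: eq_bigr => s _.
rewrite mulr_sumr mulr_suml; apply: eq_bigr => x _; rewrite /K /=; ring.
Qed.

End MarkovExpectation.

(** * Martingale plus boundary term, and the limit of the variance *)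

Section MartingaleDecomposition.
Context {d : measure_display} {T : measurableType d} {R : realType}.
Variable P : probability T R.
Context {S : finType}.
Variables (W g : S -> S -> R) (X : nat -> T -> S).
Hypothesis XW : markov_process P W X.
Variables (m kappa : R) (h f : S -> R).

Definition increment x x' : R := g x x' - m + h x - h x'.

Hypothesis increment_mean : forall x', \sum_x W x x' * increment x x' = 0.
Hypothesis increment_variance : forall x',
  \sum_x W x x' * increment x x' ^+ 2 = kappa + f x' - \sum_x W x x' * f x.

Definition martingale n (t : T) : R :=
  \sum_(i < n) increment (X i.+1 t) (X i t).

Local Notation adapted := (adapted X).
Local Notation mean := (mean P).

Lemma adapted_martingale n : adapted n (martingale n).
Proof.
by move=> a b ab; apply: eq_bigr => i _; rewrite !ab// ltnW.
Qed.

Lemma martingaleS n t :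
  martingale n.+1 t = martingale n t + increment (X n.+1 t) (X n t).
Proof. by rewrite /martingale big_ord_recr. Qed.

Lemma adapted_step n (G : S -> S -> R) :
  adapted n.+1 (fun t => G (X n.+1 t) (X n t)).
Proof. by move=> a b ab; rewrite !ab. Qed.

Lemma adaptedW n (Y : T -> R) : adapted n Y -> adapted n.+1 Y.
Proof. by move=> aY a b ab; apply: aY => i ni; rewrite ab// ltnW. Qed.

Lemma mean_mul_increment n Y : adapted n Y ->
  mean (fun t => Y t * increment (X n.+1 t) (X n t)) = 0.
Proof.
move=> aY; rewrite (mean_markov XW)//.
rewrite (_ : (fun _ => _) = fun=> 0) ?mean_cst//.
by apply/funext => t; rewrite increment_mean mulr0.
Qed.

Lemma mean_transition n (u : S -> R) :
  mean (fun t => \sum_x W x (X n t) * u x) = mean (fun t => u (X n.+1 t)).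
Proof.
have a1 : adapted n (fun=> 1 : R) by [].
have := mean_markov XW (fun x _ => u x) a1.
under eq_fun do rewrite mul1r.
by move=> ->; congr mean; apply/funext => t; rewrite mul1r.
Qed.

Lemma mean_martingale n : mean (martingale n) = 0.
Proof.
elim: n => [|n IH].
  rewrite (_ : martingale 0 = fun=> 0) ?mean_cst//.
  by apply/funext => t; rewrite /martingale big_ord0.
rewrite (_ : martingale n.+1 =
  fun t => martingale n t + 1 * increment (X n.+1 t) (X n t)); last first.
  by apply/funext => t; rewrite martingaleS mul1r.
rewrite (meanD XW (n := n.+1)).
- by rewrite IH add0r mean_mul_increment.
- exact/adaptedW/adapted_martingale.
- exact: (adapted_step (fun x x' => 1 * increment x x')).
Qed.

(** Increments are orthogonal to the past, so only the conditional variances accumulate; their [f]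
    part telescopes in expectation. *)
Lemma mean_martingale_sqr n : mean (fun t => martingale n t ^+ 2) =
  n%:R * kappa + (mean (fun t => f (X 0 t)) - mean (fun t => f (X n t))).
Proof.
elim: n => [|n IH].
  rewrite mul0r add0r subrr (_ : (fun _ => _) = fun=> 0) ?mean_cst//.
  by apply/funext => t; rewrite /martingale big_ord0 expr0n.
have aM := @adapted_martingale n.
have a2M : adapted n (fun t => 2 * martingale n t) by move=> a b /aM ->.
have aW : adapted n (fun t => \sum_x W x (X n t) * f x).
  by move=> a b ab; rewrite ab.
have af : adapted n (fun t => f (X n t)) by move=> a b ab; rewrite ab.
have q : mean (fun t => increment (X n.+1 t) (X n t) ^+ 2) =
    kappa + mean (fun t => f (X n t)) - mean (fun t => f (X n.+1 t)).
  have a1 : adapted n (fun=> 1 : R) by [].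
  have := mean_markov XW (fun x x' => increment x x' ^+ 2) a1.
  under eq_fun do rewrite mul1r.
  move=> ->; under eq_fun do rewrite mul1r increment_variance -mulN1r.
  rewrite (meanD XW (n := n)).
  - rewrite (meanD XW (n := n))// mean_cst (meanZ XW (n := n))// mulN1r.
    by rewrite mean_transition.
  - by move=> a b ab; rewrite ab.
  - by move=> a b /aW ->.
rewrite (_ : (fun _ => _) = fun t => (martingale n t ^+ 2 +
    2 * martingale n t * increment (X n.+1 t) (X n t)) +
    increment (X n.+1 t) (X n t) ^+ 2); last first.
  by apply/funext => t; rewrite martingaleS; ring.
have aM2 : adapted n.+1 (fun t => martingale n t ^+ 2).
  by apply: adaptedW => a b /aM ->.
have aMD : adapted n.+1
    (fun t => 2 * martingale n t * increment (X n.+1 t) (X n t)).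
  by move=> a b ab; rewrite (adaptedW aM ab) !ab.
rewrite (meanD XW (n := n.+1)); last 2 first.
- by move=> a b ab; rewrite (aM2 _ _ ab) (aMD _ _ ab).
- exact: (adapted_step (fun x x' => increment x x' ^+ 2)).
rewrite (meanD XW (n := n.+1))// IH mean_mul_increment// q -natr1.
ring.
Qed.

Lemma mean_norm_le n Y (B : R) : adapted n Y -> (forall t, `|Y t| <= B) ->
  `|mean Y| <= B.
Proof.
move=> aY YB; rewrite ler_norml; apply/andP; split.
- rewrite -[leLHS](mean_cst P); apply: (mean_le XW (n := n)) => // t.
  by have := YB t; rewrite ler_norml => /andP[].
- rewrite -[leRHS](mean_cst P); apply: (mean_le XW (n := n)) => // t.
  by have := YB t; rewrite ler_norml => /andP[].
Qed.

Definition abs_sum (u : S -> R) : R := \sum_x `|u x|.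

Lemma le_abs_sum (u : S -> R) x : `|u x| <= abs_sum u.
Proof. by rewrite /abs_sum (bigD1 x)//= lerDl sumr_ge0. Qed.

Definition boundary n (t : T) : R := h (X 0 t) - h (X n t).

Definition centered_boundary n (t : T) : R :=
  boundary n t - mean (boundary n).

Lemma adapted_boundary n : adapted n (boundary n).
Proof. by move=> a b ab; rewrite /boundary !ab. Qed.

Lemma centered_boundary_sqr_le n t :
  centered_boundary n t ^+ 2 <= (4 * abs_sum h) ^+ 2.
Proof.
(* The same bound holds for the mean of the boundary term, whence the factor 4 = 2 + 2 after
   centering. *)
have b2 s : `|boundary n s| <= 2 * abs_sum h.
  rewrite (le_trans (ler_normB _ _))//.
  by have := le_abs_sum h (X 0 s); have := le_abs_sum h (X n s); lra.
rewrite -real_normK ?num_real// lerXn2r ?nnegrE//.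
  by rewrite mulr_ge0// sumr_ge0.
rewrite (le_trans (ler_normB _ _))//.
by have := b2 t; have := mean_norm_le (@adapted_boundary n) b2; lra.
Qed.

Lemma sum_martingale n t : \sum_(i < n) g (X i.+1 t) (X i t) =
  n%:R * m + martingale n t + boundary n t.
Proof.
elim: n => [|n IH].
  by rewrite /martingale !big_ord0 /boundary subrr mul0r !addr0.
rewrite big_ord_recr/= IH martingaleS /boundary /increment -natr1; ring.
Qed.

(** The martingale has mean 0, so centering affects only the boundary term; n times the squared
    factor 1/n leaves 1/n. *)
Lemma variance_sample_mean n : (0 < n)%N ->
  (n%:R%:E * 'V_P[sample_mean g X n])%E =
  (n%:R^-1 * mean (fun t => (martingale n t + centered_boundary n t) ^+ 2))%:E.
Proof.
move=> n0; have nR : n%:R != 0 :> R by rewrite pnatr_eq0 -lt0n.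
have aM := @adapted_martingale n; have aB := @adapted_boundary n.
have aS : adapted n (fun t => martingale n t + boundary n t).
  by move=> a b ab; rewrite (aM _ _ ab) (aB _ _ ab).
have sE : sample_mean g X n = fun t => m + n%:R^-1 * (martingale n t + boundary n t).
  apply/funext => t; rewrite /sample_mean sum_martingale -addrA mulrDr mulrA.
  by rewrite mulVf// mul1r.
have ms : fine 'E_P[sample_mean g X n]%E = m + n%:R^-1 * mean (boundary n).
  rewrite -/(mean _) sE (meanD XW (n := n))//; last by move=> a b /aS ->.
  by rewrite mean_cst (meanZ XW (n := n))// (meanD XW (n := n))// mean_martingale add0r.
have aC : adapted n (fun t => (martingale n t + centered_boundary n t) ^+ 2).
  by move=> a b ab; rewrite /centered_boundary (aM _ _ ab) (aB _ _ ab).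
rewrite /variance unlock ms.
rewrite (_ : (_ * _)%R = fun t => n%:R^-1 ^+ 2 *
  (martingale n t + centered_boundary n t) ^+ 2); last first.
  apply/funext => t; set c := m + _.
  transitivity ((sample_mean g X n t - c) * (sample_mean g X n t - c)) => //.
  by rewrite sE /c /centered_boundary; ring.
rewrite (expectation_adapted XW (n := n)); last by move=> a b /aC ->.
rewrite (meanZ XW (n := n))// -EFinM mulrA; congr (_ * _)%:E.
by rewrite expr2 mulrA mulfV// mul1r.
Qed.

(** In the expanded square, the martingale part contributes n kappa + O(1) and the boundary part
    O(1), leaving the cross term to be bounded. *)
Lemma cvg_variance_sample_mean :
  (n%:R%:E * 'V_P[sample_mean g X n])%E @[n --> \oo] --> kappa%:E.
Proof.
(* The first summand bounds the difference of the means of [f] at times 0 and n, the second the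
   squared centered boundary. *)
pose B := 2 * abs_sum f + (4 * abs_sum h) ^+ 2.
have aM n := @adapted_martingale n.
have aC n : adapted n (centered_boundary n).
  by move=> a b ab; rewrite /centered_boundary (@adapted_boundary n _ _ ab).
have aM2 n : adapted n (fun t => martingale n t ^+ 2).
  by move=> a b ab; rewrite (aM n _ _ ab).
have aC2 n : adapted n (fun t => centered_boundary n t ^+ 2).
  by move=> a b ab; rewrite (aC n _ _ ab).
have aMC n : adapted n (fun t => martingale n t * centered_boundary n t).
  by move=> a b ab; rewrite (aM n _ _ ab) (aC n _ _ ab).
pose r n := mean (fun t => f (X 0 t)) - mean (fun t => f (X n t))
  + mean (fun t => centered_boundary n t ^+ 2).
pose z n := mean (fun t => martingale n t * centered_boundary n t).
have fB n : `|mean (fun t => f (X n t))| <= abs_sum f.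
  by apply: (mean_norm_le (n := n)) => [a b ab|t]; [rewrite ab|exact: le_abs_sum].
have c2 n : `|mean (fun t => centered_boundary n t ^+ 2)| <= (4 * abs_sum h) ^+ 2.
  apply: (mean_norm_le (n := n)) => // t.
  by rewrite ger0_norm ?sqr_ge0// centered_boundary_sqr_le.
apply/fine_cvgP; split.
  by exists 1%N => // n /= n1; rewrite variance_sample_mean.
apply: (cvg_quadratic_remainder (B := B) (r := r) (z := z)) => [n n0|n|n t t0].
- rewrite /= variance_sample_mean//=.
  rewrite (_ : (fun _ => _) = fun t => (martingale n t ^+ 2 +
    2 * (martingale n t * centered_boundary n t)) + centered_boundary n t ^+ 2);
    last by apply/funext => t; ring.
  have a2 : adapted n (fun t => 2 * (martingale n t * centered_boundary n t)).
    by move=> a b /aMC ->.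
  rewrite (meanD XW (n := n))//; last first.
    by move=> a b ab; rewrite (aM2 n _ _ ab) (a2 _ _ ab).
  rewrite (meanD XW (n := n))// (meanZ XW (n := n))// mean_martingale_sqr.
  have nR : n%:R != 0 :> R by rewrite pnatr_eq0 -lt0n.
  rewrite /r /z; field.
  exact: nR.
- rewrite /r /B.
  have := fB 0; have := fB n; have := c2 n; rewrite !ler_norml.
  by move=> /andP[? ?] /andP[? ?] /andP[? ?]; apply/andP; split; lra.
- (* AM-GM in place of Cauchy-Schwarz: [t * (M + s * t^-1 * c) ^+ 2 >= 0] *)
  have key (s : R) : s ^+ 2 = 1 ->
      - (2 * s * z n) <= t * mean (fun t => martingale n t ^+ 2)
        + t^-1 * mean (fun t => centered_boundary n t ^+ 2).
    move=> s1; rewrite -subr_ge0 opprK -(meanZ XW _ (aM2 n)) -(meanZ XW _ (aC2 n)).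
    rewrite -(meanZ XW _ (aMC n)) -!(meanD XW (n := n)).
    + apply: mean_ge0 => a.
      set x := martingale n a; set c := centered_boundary n a.
      have -> : t * x ^+ 2 + t^-1 * c ^+ 2 + 2 * s * (x * c) =
          t * (x + s * t^-1 * c) ^+ 2.
        have -> : t^-1 * c ^+ 2 = s ^+ 2 * (t^-1 * c ^+ 2) by rewrite s1 mul1r.
        by field; rewrite gt_eqF.
      by rewrite mulr_ge0 ?sqr_ge0// ltW.
    + by move=> a b ab; rewrite (aM2 n _ _ ab) (aC2 n _ _ ab).
    + by move=> a b /aMC ->.
    + by move=> a b /aM2 ->.
    + by move=> a b /aC2 ->.
  have k1 := key 1 (expr1n _ _); have k2 := key (-1) (etrans (sqrrN _) (expr1n _ _)).
  have hM : t * mean (fun t => martingale n t ^+ 2) <= t * (n%:R * kappa + B).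
    rewrite ler_wpM2l ?(ltW t0)// mean_martingale_sqr /B.
    have := fB 0; have := fB n; rewrite !ler_norml.
    have := sqr_ge0 (4 * abs_sum h).
    by move=> ? /andP[? ?] /andP[? ?]; lra.
  have hC : t^-1 * mean (fun t => centered_boundary n t ^+ 2) <= t^-1 * B.
    rewrite ler_wpM2l ?invr_ge0 ?(ltW t0)// /B.
    have := c2 n; rewrite ler_norml => /andP[_ h1].
    have h2 : 0 <= abs_sum f by exact: sumr_ge0.
    by lra.
  by rewrite ler_norml; apply/andP; split; lra.
Qed.

End MartingaleDecomposition.

(** * From matrices indexed by ordinals back to the state space *)

Section Transfer.
Context {R : realType} {S : finType}.
Variables (W g : S -> S -> R).

Lemma sum_enum_val (F : S -> R) : \sum_(i < #|S|) F (enum_val i) = \sum_x F x.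
Proof. by rewrite [RHS](reindex _ (onW_bij _ (@enum_val_bij S))). Qed.

Lemma tilt_mx_of t : tilt (mx_of W) (mx_of g) t = mx_of (tilted W g t).
Proof. by apply/matrixP => i j; rewrite !mxE. Qed.

Lemma pf_eigenvalueE (A : S -> S -> R) r :
  is_pf_eigenvalue A r -> pf_eigenvalue A = r.
Proof.
move=> Ar; apply: (is_pf_eigenvalue_unique _ Ar).
by apply: (@xgetPex _ 0 [set r | is_pf_eigenvalue A r]); exists r.
Qed.

(** The state [s0] supplies the reference index at which the left eigenvector is normalised. *)
Lemma log_pf_poisson (s0 : S) : transition_matrix W -> irreducible W ->
  exists m kappa (h f : S -> R),
  [/\ jet2 (log_pf W g) 0 m kappa,
     forall x', \sum_x W x x' * increment g m h x x' = 0 &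
     forall x', \sum_x W x x' * increment g m h x x' ^+ 2
       = kappa + f x' - \sum_x W x x' * f x].
Proof.
move=> [W0 W1] irr; pose w := mx_of W.
have w0 i j : 0 <= w i j by rewrite mxE.
have w1 j : \sum_i w i j = 1.
  rewrite -(W1 (enum_val j)) -sum_enum_val.
  by apply: eq_bigr => i _; rewrite mxE.
have wirr i j : exists k, 0 < (w ^+ k) i j.
  have [k] := irr (enum_val i) (enum_val j).
  by rewrite /mxpow !enum_valK; exists k.
have lamE t r : eigenvalue (tilt w (mx_of g) t) r ->
    (forall z : R[i],
      eigenvalue (map_mx (real_complex R) (tilt w (mx_of g) t)) z ->
      `|z| <= (r%:C)%C) -> pf_eigenvalue (tilted W g t) = r.
  by rewrite tilt_mx_of => er zr; exact: pf_eigenvalueE.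
have [m [kappa [h [f [jl e1 e2]]]]] :=
  poisson_solution (enum_rank s0) w0 w1 wirr lamE.
exists m, kappa, (h \o enum_rank), (f \o enum_rank); split=> // x'.
- rewrite -[RHS](e1 (enum_rank x')) -sum_enum_val.
  by apply: eq_bigr => i _; rewrite /increment /= !mxE !enum_valK enum_rankK.
- rewrite -!sum_enum_val /=; under [in RHS]eq_bigr do rewrite enum_valK.
  have := e2 (enum_rank x'); under [in RHS]eq_bigr do rewrite mxE enum_rankK.
  move=> <-; apply: eq_bigr => i _.
  by rewrite /increment /= !mxE !enum_valK enum_rankK.
Qed.

Lemma jet2_derive1 (u : R -> R) a b c : jet2 u a b c ->
  [/\ \forall t \near (0 : R), derivable u t 1, derivable (derive1 u) 0 1 &
      derive1n 2 u 0 = c].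
Proof.
move=> [u1 [_ u1P _ uc]].
have e : \forall t \near (0 : R), u1 t = derive1 u t.
  by apply: filterS u1P => t [_ <-]; rewrite derive1E.
have [d dc] : is_derive (0 : R) 1 (derive1 u) c by exact: near_eq_is_derive uc.
split; [by apply: filterS u1P => t []|exact: d|].
by rewrite -dc -derive1E.
Qed.

End Transfer.

Theorem mainTheorem5 (R : realType) (S : finType) (W g : S -> S -> R)
    (d : measure_display) (T : measurableType d) (P : probability T R)
    (X : nat -> T -> S)
    (W_transition : transition_matrix W)
    (W_irreducible : irreducible W)
    (W_ergodic : ergodic W)
    (X_markov : markov_process P W X) :
  (\forall theta \near (0 : R), derivable (log_pf W g) theta 1) /\
  derivable (derive1 (log_pf W g)) 0 1 /\
  (n%:R%:E * 'V_P[sample_mean g X n])%E @[n --> \oo]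
    --> (derive1n 2 (log_pf W g) 0)%:E.
Proof.
(* Total mass 1 forces a sample point, and X_0 there provides a state of [S]. *)
have [t _] : [set: T] !=set0.
  apply/set0P/negP => /eqP T0; have := probability_setT P.
  by rewrite T0 measure0 => /eqP; rewrite eqe eq_sym oner_eq0.
have [m [kappa [h [f [jl e1 e2]]]]] :=
  log_pf_poisson g (X 0 t) W_transition W_irreducible.
have [d1 d2 ->] := jet2_derive1 jl; do 2 split=> //.
exact: (cvg_variance_sample_mean X_markov e1 e2).
Qed.
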